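(* Let $m\ge1$ and let $G_P,G_Q$ be two full-support binary context machines of order $m$, each with pairwise distinct parameters, generating processes $P,Q$. Let $$n_{\mathrm{struct}}=L_{\mathrm{tar}}(G_P)+L_{\mathrm{tar}}(G_Q)+\max\{L_{\mathrm{sep}}(G_P),L_{\mathrm{sep}}(G_Q)\}+1,$$ let $n_{\mathrm{count}}=r+s-1$, where $r,s$ are the numbers of states of $G_P,G_Q$, and let $n_{\mathrm{rank}}=r'+s'-1$, where $r',s'$ are the ranks of the process Hankel matrices of $P,Q$. Then $$n_{\mathrm{struct}}=2m+2,\qquad n_{\mathrm{count}}=n_{\mathrm{rank}}=2^{m+1}-1.$$ Moreover $n_{\mathrm{struct}}<n_{\mathrm{count}}$ for every $m\ge2$, and $$\frac{n_{\mathrm{count}}}{n_{\mathrm{struct}}}=\frac{2^{m+1}-1}{2m+2}=\Theta\!\left(\frac{2^m}{m}\right).$$ Furthermore, no contiguous block horizon at most $m$ gives uniform identifiability on $\Theta_{\mathrm{ex}}(m,1)$ (over the alphabet $\{0,1\}$): for every $0\le n\le m$ there are $P,Q\in\Theta_{\mathrm{ex}}(m,1)$ with $P_n=Q_n$ and $G_P\not\cong G_Q$.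
   Context: Words. $\mathcal X$ is a nonempty finite alphabet (here $\{0,1\}$), $\mathcal X^m$ the words of length $m$, $\mathcal X^*$ all finite words, $\lambda$ the empty word; $X_i^j=(X_i,\dots,X_j)$. Generator. A finite-state generator $\epsilon$-machine over $\mathcal X$ is $G=(\mathcal S,\pi,\delta,\{e_\sigma\}_{\sigma\in\mathcal S})$ where: (1) $\mathcal S$ is a nonempty finite set of states and each $e_\sigma$ is a probability mass function on $\mathcal X$; (2) a pair $(\sigma,x)$ is admissible when $e_\sigma(x)>0$, and a successor $\delta(\sigma,x)\in\mathcal S$ is defined exactly on admissible pairs; (3) the directed graph of positive-probability labeled transitions $\sigma\to\delta(\sigma,x)$ is strongly connected; (4) for $\sigma\neq\tau$ there is a word $w\in\mathcal X^*$ with $p_\sigma(w)\neq p_\tau(w)$, where $p_\sigma(w)=P(X_1^{|w|}=w\mid S_0=\sigma)$ (so $p_\sigma(\lambda)=1$); (5) $\pi$ is the unique probability vector with $\pi T=\pi$, where $T_{\sigma\tau}=\sum_{x:\,e_\sigma(x)>0,\ \delta(\sigma,x)=\tau}e_\sigma(x)$. The dynamics are $P(X_{t+1}=x,S_{t+1}=\delta(\sigma,x)\mid S_t=\sigma)=e_\sigma(x)$ for admissible $(\sigma,x)$, and the process generated by $G$ is the observable process $(X_t)_{t\in\mathbb Z}$ of the stationary joint law with $S_0\sim\pi$. Context machines. The full-support binary context machine of order $m\ge1$ with parameters $p_u\in(0,1)$, $u\in\{0,1\}^m$, has state set $\{0,1\}^m$, update $\delta(u,x)=u_2\cdots u_mx$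 (equal to $x$ when $m=1$), and emissions $e_u(1)=p_u$, $e_u(0)=1-p_u$. Its parameters are pairwise distinct if the $2^m$ numbers $p_u$ are. Block laws. $P_n(w)=P(X_1^n=w)$ for $w\in\mathcal X^n$, $P_0(\lambda)=1$. Process Hankel matrix: $H_{u,v}=P(uv)$, $u,v\in\mathcal X^*$, where $P(w)=P(X_1^{|w|}=w)$. Synchronization. A positive-probability word $w\in\mathcal X^k$, $k\ge0$, synchronizes to $\sigma$ if $P(S_k=\sigma\mid X_1^k=w)=1$ (conditioning on $\lambda$ is trivial). $G$ is exact if it has a finite positive-probability synchronizing word. Radii. $L_{\mathrm{tar}}(G)=\max_{\sigma\in\mathcal S}\inf\{|w|: w\text{ synchronizes to }\sigma\}$ ($\inf\emptyset=\infty$) and $L_{\mathrm{sep}}(G)=\max_{\sigma\neq\tau}\min\{|v|:p_\sigma(v)\neq p_\tau(v)\}$ (both $0$ for a one-state generator). Class. $\Theta_{\mathrm{ex}}(A,D)$ is the class of stationary processes $P$ over the fixed alphabet generated by an exact finite-state generator $\epsilon$-machine $G_P$ with $L_{\mathrm{tar}}(G_P)\le A$ and $L_{\mathrm{sep}}(G_P)\le D$. Isomorphism. $G\cong G'$ if there is a bijection $f:\mathcal S\to\mathcal S'$ with $\pi'(f(\sigma))=\pi(\sigma)$, $e'_{f(\sigma)}(x)=e_\sigma(x)$ and $\delta'(f(\sigma),x)=f(\delta(\sigma,x))$ for every admissible $(\sigma,x)$. *)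

(* Defs.v *)
From HB Require Import structures.
From mathcomp Require Import all_boot all_order all_algebra.
From mathcomp Require Import all_classical all_reals all_analysis.

Set Implicit Arguments.
Unset Strict Implicit.
Unset Printing Implicit Defensive.

Import Order.TTheory GRing.Theory Num.Theory.
Import numFieldNormedType.Exports.

Local Open Scope classical_set_scope.
Local Open Scope ring_scope.

(** Stationary vectors of finite Markov chains *)

Definition prob_vector (R : realType) (S : finType) (mu : S -> R) :=
  (forall s, 0 <= mu s) /\ \sum_s mu s = 1.

Definition invariant_vector (R : realType) (S : finType) (T : S -> S -> R)
    (mu : S -> R) :=
  forall t, \sum_s mu s * T s t = mu t.

Lemma invariant_norm (R : realType) (S : finType) (T : S -> S -> R) (f : S -> R) :
  (forall s t, 0 <= T s t) -> (forall s, \sum_t T s t = 1) ->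
  invariant_vector T f -> invariant_vector T (fun s => `|f s|).
Proof.
move=> T0 T1 fT.
have le t : 0 <= \sum_s `|f s| * T s t - `|f t|.
  rewrite subr_ge0 -[X in `|X|]fT; apply: le_trans (ler_norm_sum _ _ _) _.
  by apply: ler_sum => s _; rewrite normrM (ger0_norm (T0 _ _)).
have sum0 : \sum_t (\sum_s `|f s| * T s t - `|f t|) = 0.
  rewrite sumrB exchange_big /= -sumrB big1 // => s _.
  by rewrite -mulr_sumr T1 mulr1 subrr.
move=> t; apply/eqP; rewrite -subr_eq0; apply/eqP.
by apply: (psumr_eq0P _ sum0) => // s _; exact: le.
Qed.

Lemma invariant_exists (R : realType) (S : finType) (T : S -> S -> R) (s0 : S) :
  (forall s t, 0 <= T s t) -> (forall s, \sum_t T s t = 1) ->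
  exists mu, prob_vector mu /\ invariant_vector T mu.
Proof.
move=> T0 T1.
pose A : 'M[R]_#|S| :=
  \matrix_(i, j) (T (enum_val i) (enum_val j) - (i == j)%:R).
have : \det A == 0.
  rewrite -det_tr; apply/det0P; exists (const_mx 1).
    by apply/eqP => /rowP/(_ (enum_rank s0)); rewrite !mxE; exact/eqP/oner_neq0.
  apply/rowP => i; rewrite !mxE.
  under eq_bigr do rewrite !mxE mul1r.
  rewrite sumrB (bigD1 (P := predT) (F := fun j => (i == j)%:R) i) //= eqxx.
  rewrite [X in _ - (_ + X)]big1 ?addr0; last by move=> j; rewrite eq_sym => /negbTE->.
  by rewrite -(T1 (enum_val i)) (reindex _ (onW_bij _ (@enum_val_bij S))) subrr.
move=> /det0P[v v0 vA].
pose f s := v 0 (enum_rank s).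
have fT : invariant_vector T f.
  move=> t; have /rowP/(_ (enum_rank t)) := vA; rewrite !mxE.
  under eq_bigr do rewrite !mxE enum_rankK mulrBr.
  rewrite sumrB (bigD1 (P := predT) (F := fun j => _ * (j == _)%:R) (enum_rank t)) //=.
  rewrite eqxx mulr1 [X in _ - (_ + X)]big1 ?addr0; last first.
    by move=> j /negbTE->; rewrite mulr0.
  move/eqP; rewrite subr_eq0 [RHS]/f => /eqP <-.
  rewrite (reindex _ (onW_bij _ (@enum_rank_bij S))) /=.
  by apply: eq_bigr => s _; rewrite enum_rankK.
have gT := invariant_norm T0 T1 fT.
have [s fs0] : exists s, f s != 0.
  apply/existsP; apply: contra_neqT v0 => /existsPn h.
  by apply/rowP => i; rewrite mxE -(enum_valK i); apply/eqP; have := h (enum_val i); rewrite negbK.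
set c := \sum_s `|f s|.
have c0 : 0 < c.
  by rewrite /c (bigD1 s) //= ltr_pwDl ?normr_gt0 // sumr_ge0.
exists (fun s => `|f s| / c); split; first split.
- by move=> t; rewrite divr_ge0 // ltW.
- by rewrite -mulr_suml divff // gt_eqF.
- move=> t; rewrite -gT mulr_suml; apply: eq_bigr => u _.
  by rewrite mulrAC.
Qed.

Lemma invariant_unique (R : realType) (S : finType) (T : S -> S -> R)
    (mu nu : S -> R) :
  (forall s t, 0 <= T s t) -> (forall s, \sum_t T s t = 1) ->
  (forall s t, connect [rel s t | 0 < T s t] s t) ->
  prob_vector mu -> invariant_vector T mu ->
  prob_vector nu -> invariant_vector T nu -> mu =1 nu.
Proof.
move=> T0 T1 Tc.
have pos w : (forall s, 0 <= w s) -> invariant_vector T w ->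
    forall s t, 0 < w s -> 0 < w t.
  move=> w0 wT s t ws; have /connectP[r + ->] := Tc s t.
  elim: r s ws => //= a r IH s ws /andP[Tsa]; apply: IH.
  by rewrite -wT (bigD1 s) //= ltr_pwDl ?mulr_gt0 // sumr_ge0 // => *; rewrite mulr_ge0.
suff le a b : prob_vector a -> invariant_vector T a ->
    prob_vector b -> invariant_vector T b -> forall s, a s <= b s.
  by move=> ? ? ? ? s; apply/eqP; rewrite eq_le !le.
move=> [_ a1] aT [_ b1] bT s; rewrite leNgt; apply/negP => abs.
pose f u := a u - b u.
have fT : invariant_vector T f.
  move=> t; rewrite /f -aT -bT -sumrB; apply: eq_bigr => u _.
  by rewrite mulrBl.
pose h u := `|f u| + f u.
have h0 u : 0 <= h u by rewrite /h -lerBlDr sub0r -normrN ler_norm.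
have hT : invariant_vector T h.
  move=> t; rewrite /h -{2}fT -(invariant_norm T0 T1 fT) -big_split /=.
  by apply: eq_bigr => u _; rewrite mulrDl.
have fs : 0 < f s by rewrite subr_gt0.
have hs : 0 < h s by rewrite /h addr_gt0 // normr_gt0 gt_eqF.
have fpos u : 0 < f u.
  have := pos _ h0 hT _ u hs; rewrite /h; case: (ltrP 0 (f u)) => // fu.
  by rewrite ler0_norm // addNr ltxx.
have : \sum_u f u = 0 by rewrite /f sumrB a1 b1 subrr.
move/psumr_eq0P => /(_ (fun u _ => ltW (fpos u)) s isT) /eqP.
by rewrite gt_eqF.
Qed.

(** Dynamics of a unifilar labelled chain *)

Definition transition (R : realType) (X S : finType) (emit : S -> X -> R)
    (next : S -> X -> option S) (s t : S) : R :=
  \sum_(x | next s x == Some t) emit s x.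

Fixpoint word_prob (R : realType) (X S : finType) (emit : S -> X -> R)
    (next : S -> X -> option S) (s : S) (w : seq X) : R :=
  if w is x :: w' then
    if next s x is Some t then emit s x * word_prob emit next t w' else 0
  else 1.

Fixpoint run (X S : finType) (next : S -> X -> option S) (s : S) (w : seq X) :
    option S :=
  if w is x :: w' then obind (run next ^~ w') (next s x) else Some s.

(** Finite-state generator epsilon-machines *)

Record emachine (R : realType) (X : finType) := EMachine {
  state : finType;
  init : state -> R;
  next : state -> X -> option state;
  emit : state -> X -> R;
  state_nonempty : (0 < #|state|)%N;
  emit_pmf : forall s, prob_vector (emit s);
  next_dom : forall s x, isSome (next s x) = (0 < emit s x);
  strongly_connected : forall s t,
    connect [rel a b | [exists x, next a x == Some b]] s t;
  state_separated : forall s t, s != t ->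
    exists w, word_prob emit next s w != word_prob emit next t w;
  init_prob : prob_vector init;
  init_inv : invariant_vector (transition emit next) init;
  init_unique : forall mu, prob_vector mu ->
    invariant_vector (transition emit next) mu -> mu =1 init }.

Definition wprob (R : realType) (X : finType) (G : emachine R X) :=
  word_prob (@emit R X G) (@next R X G).

Definition isomorphic (R : realType) (X : finType) (G G' : emachine R X) :=
  exists f : state G -> state G', [/\ bijective f,
    forall s, init (f s) = init s,
    forall s x, emit (f s) x = emit s x &
    forall s x, 0 < emit s x -> next (f s) x = omap f (next s x)].

(* P(X_1^k = w) and P(X_1^k = w, S_k = s) for S_0 distributed as init *)
Definition machine_word (R : realType) (X : finType) (G : emachine R X)
    (w : seq X) : R :=
  \sum_s init s * wprob (G := G) s w.

Definition machine_word_state (R : realType) (X : finType) (G : emachine R X)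
    (w : seq X) (t : state G) : R :=
  \sum_(s | run (@next R X G) s w == Some t) init s * wprob s w.

Definition synchronizes (R : realType) (X : finType) (G : emachine R X)
    (w : seq X) (s : state G) :=
  0 < machine_word G w /\ machine_word_state w s / machine_word G w = 1.

Definition is_exact (R : realType) (X : finType) (G : emachine R X) :=
  exists w (s : state G), synchronizes w s.

(* the infimum of the empty set is +oo; the maxima are over sets of
   nonnegative values, so the default 0 only matters when the index set is
   empty *)
Definition L_tar (R : realType) (X : finType) (G : emachine R X) : \bar R :=
  \big[maxe/0%E]_(s : state G)
    ereal_inf [set ((size w)%:R)%:E | w in [set w | synchronizes w s]].

Definition L_sep (R : realType) (X : finType) (G : emachine R X) : \bar R :=
  \big[maxe/0%E]_(st : state G * state G | st.1 != st.2)
    ereal_inf [set ((size v)%:R)%:E |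
      v in [set v | wprob st.1 v != wprob st.2 v]].

(** Processes indexed by the integers, with values in a finite alphabet *)

Record process (R : realType) (A : finType) := Process {
  sample_display : measure_display;
  sample : measurableType sample_display;
  law : probability sample R;
  obs : int -> sample -> A;
  obs_measurable : forall t a, measurable (obs t @^-1` [set a]) }.

(* (X_(t+1), ..., X_(t+n)) *)
Definition window (R : realType) (A : finType) (P : process R A) (t : int)
    (n : nat) (o : sample P) : seq A :=
  [seq obs (t + i%:Z) o | i <- iota 1 n].

Definition block_prob (R : realType) (A : finType) (P : process R A) (t : int)
    (w : seq A) : R :=
  fine (law P [set o | window t (size w) o = w]).

Definition stationary (R : realType) (A : finType) (P : process R A) :=
  forall t t' w, block_prob P t w = block_prob P t' w.

Definition word_law (R : realType) (A : finType) (P : process R A) :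
  seq A -> R := block_prob P 0.

Definition same_block_law (R : realType) (A : finType) (n : nat)
    (P Q : process R A) :=
  forall w, size w = n -> word_law P w = word_law Q w.

(* a path lists the pairs (S_i, X_i), where X_i is emitted when the state
   moves from S_(i-1) to S_i *)
Fixpoint path_prob (R : realType) (X : finType) (G : emachine R X)
    (s : state G) (z : seq (state G * X)%type) : R :=
  if z is (s', x) :: z' then
    (if next s x == Some s' then emit s x else 0) * path_prob s' z'
  else 1.

Definition machine_process (R : realType) (X : finType) (G : emachine R X)
    (J : process R (state G * X)%type) :=
  forall t (s : state G) z,
    law J [set o | (obs t o).1 = s /\ window t (size z) o = z] =
    (init s * path_prob s z)%:E.

Definition generates (R : realType) (X : finType) (G : emachine R X)
    (P : process R X) :=
  exists2 J : process R (state G * X)%type, machine_process J &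
    forall t w,
      law P [set o | window t (size w) o = w] =
      law J [set o | map snd (window t (size w) o) = w].

(** [presents A D G P]: [G] is an admissible choice of [G_P] in the class
    [Theta_ex A D] *)

Definition presents (R : realType) (X : finType) (A D : nat)
    (G : emachine R X) (P : process R X) :=
  [/\ generates G P, is_exact G, (L_tar G <= (A%:R)%:E)%E &
      (L_sep G <= (D%:R)%:E)%E].

Definition Theta_ex (R : realType) (X : finType) (A D : nat)
    (P : process R X) :=
  stationary P /\ exists G, presents A D G P.

Definition hankel (R : realType) (A : finType) (P : process R A) (u v : seq A) :
    R :=
  word_law P (u ++ v).

(* rank of an infinite matrix: supremum of the ranks of its finite submatrices *)
Definition infinite_rank (R : realType) (I J : Type) (H : I -> J -> R) :
    \bar R :=
  ereal_sup [set r | exists k l (u : 'I_k -> I) (v : 'I_l -> J),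
    r = ((\rank (\matrix_(i < k, j < l) H (u i) (v j)))%:R)%:E].

Definition hankel_rank (R : realType) (A : finType) (P : process R A) : \bar R :=
  infinite_rank (hankel P).

Definition n_struct (R : realType) (X : finType) (G G' : emachine R X) :
    \bar R :=
  (L_tar G + L_tar G' + maxe (L_sep G) (L_sep G') + 1)%E.

Definition n_count (R : realType) (X : finType) (G G' : emachine R X) : nat :=
  (#|state G| + #|state G'| - 1)%N.

Definition n_rank (R : realType) (X : finType) (P Q : process R X) : \bar R :=
  (hankel_rank P + hankel_rank Q - 1)%E.

(** Binary context machines *)

Definition context_next (m : nat) (u : m.-tuple bool) (x : bool) :
    m.-tuple bool :=
  behead_tuple (rcons_tuple u x).

Definition context_emit (R : realType) (m : nat) (p : m.-tuple bool -> R)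
    (u : m.-tuple bool) (x : bool) : R :=
  if x then p u else 1 - p u.

Section ContextMachine.
Context (R : realType) (m : nat) (p : m.-tuple bool -> R).
Hypothesis p_bound : forall u, 0 < p u < 1.

Let delta (u : m.-tuple bool) (x : bool) := Some (context_next u x).
Let e := context_emit p.
Let T := transition e delta.

Lemma context_emit_gt0 u x : 0 < e u x.
Proof.
by rewrite /e /context_emit; have /andP[] := p_bound u; case: x; rewrite ?subr_gt0.
Qed.

Lemma context_pmf u : prob_vector (e u).
Proof.
split=> [x|]; first exact/ltW/context_emit_gt0.
by rewrite big_bool /e /context_emit /= addrC subrK.
Qed.

Lemma context_dom u x : isSome (delta u x) = (0 < e u x).
Proof. by rewrite context_emit_gt0. Qed.

Lemma context_foldl (u : m.-tuple bool) (w : seq bool) :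
  val (foldl (@context_next m) u w) = drop (size w) (u ++ w).
Proof.
elim: w u => [|x w IH] u /=; first by rewrite cats0 drop0.
rewrite IH /= -cat_rcons -drop1 -[in RHS]addn1 -drop_drop; congr drop.
by rewrite !drop1; case: (u : seq bool).
Qed.

Lemma context_connected u v :
  connect [rel a b | [exists x, delta a x == Some b]] u v.
Proof.
have foldlc w a :
    connect [rel a b | [exists x, delta a x == Some b]] a (foldl (@context_next m) a w).
  elim: w a => [|x w IH] a /=; first exact: connect0.
  apply: connect_trans (IH _); apply: connect1 => /=.
  by apply/existsP; exists x.
suff -> : v = foldl (@context_next m) u v by [].
by apply: val_inj; rewrite context_foldl size_tuple drop_size_cat // size_tuple.
Qed.

Lemma context_T_ge0 u v : 0 <= T u v.
Proof. by apply: sumr_ge0 => x _; exact/ltW/context_emit_gt0. Qed.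

Lemma context_T_sum1 u : \sum_v T u v = 1.
Proof.
have [_ <-] := context_pmf u.
rewrite /T /transition (exchange_big_dep predT) //=; apply: eq_bigr => x _.
by rewrite (big_pred1 (context_next u x)) // => v; rewrite /= /delta eq_sym.
Qed.

Lemma context_init_ex :
  {mu | prob_vector mu /\ invariant_vector T mu}.
Proof.
apply/cid/(invariant_exists (nseq_tuple m false)).
  exact: context_T_ge0.
exact: context_T_sum1.
Qed.

Definition context_init := sval context_init_ex.

Lemma context_init_unique mu :
  prob_vector mu -> invariant_vector T mu -> mu =1 context_init.
Proof.
move=> mu1 muT; have [i1 iT] := svalP context_init_ex.
apply: (invariant_unique context_T_ge0 context_T_sum1) => // u v.
have := context_connected u v; apply: connect_sub => a b /= /existsP[x ab].
apply: connect1 => /=; rewrite /T /transition (bigD1 x) //=.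
rewrite ltr_pwDl ?context_emit_gt0 // sumr_ge0 // => *.
exact/ltW/context_emit_gt0.
Qed.

Hypothesis p_inj : injective p.

Lemma context_separated (u v : m.-tuple bool) : u != v ->
  exists w, word_prob e delta u w != word_prob e delta v w.
Proof.
by move=> uv; exists [:: true]; rewrite /= !mulr1 (inj_eq p_inj).
Qed.

Lemma context_nonempty : (0 < #|{: m.-tuple bool}|)%N.
Proof. by rewrite card_tuple card_bool expn_gt0. Qed.

Definition context_machine : emachine R bool :=
  EMachine context_nonempty context_pmf context_dom context_connected
    context_separated (svalP context_init_ex).1 (svalP context_init_ex).2
    context_init_unique.

End ContextMachine.

(* Main.v *)
Require Import Defs.
From HB Require Import structures.
From mathcomp Require Import all_boot all_order all_algebra.
From mathcomp Require Import all_classical all_reals all_analysis.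
From mathcomp Require Import ring lra zify.
Set Implicit Arguments.
Unset Strict Implicit.
Unset Printing Implicit Defensive.
Import Order.TTheory GRing.Theory Num.Theory.
Import numFieldNormedType.Exports.
Local Open Scope classical_set_scope.
Local Open Scope ring_scope.

(* In a context machine the joint law of an emitted word [w] of length at most [m]
   and of the final state [t] is [init t] if [t] ends with [w] and [0] otherwise.
   Hence [w] synchronizes exactly when its length is at least [m], and the Hankel
   rows of the words of length [m] are positive multiples of the functions [p_u].
   These are linearly independent: if [c] kills all words of length [m], then
   pushing [c] through any word of length [m] gives [0]; and if both one-letter
   images of a weight vector vanish, then on each pair of states with the same
   suffix its weights [x, y] satisfy [x + y = 0] and [x p + y p' = 0] with
   [p <> p'], so that it vanishes itself.

   For the last claim, parameters with [p (0v) + p (1v) = 1] make the uniform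
   distribution on contexts stationary, so all these machines have the same laws
   of blocks of length at most [m], while blocks of length [m + 1] determine the
   parameters.  The processes themselves are realised on [[0, 1]] by nested
   partitions into intervals whose lengths are the probabilities of the blocks
   around the origin. *)

(* [next] alone would denote the successor in a cyclic sequence. *)
Local Notation next := Defs.next.

(** * Processes with given block laws *)

Lemma measure_fibers d (T : measurableType d) (R : realType)
    (mu : {measure set T -> \bar R}) (A : finType) (f : T -> A) (E : set T) :
  (forall a, measurable (f @^-1` [set a])) -> measurable E ->
  mu E = (\sum_(a : A) mu (E `&` f @^-1` [set a]))%E.
Proof.
move=> mf mE.
have mEf a : measurable (E `&` f @^-1` [set a]) by exact: measurableI.
rewrite [X in mu X](_ : E = \bigcup_(a in [set: A]) (E `&` f @^-1` [set a])).
  rewrite measure_fin_bigcup //; first last.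
  - by move=> a b _ _ [y [[_ /= <-] [_ /= <-]]].
  - exact: finite_finset.
  - rewrite (_ : [set: A] = [set` index_enum A]) -?fsbig_seq ?index_enum_uniq //.
    by apply/seteqP; split => a //= _; exact: mem_index_enum.
apply/seteqP; split => o; first by move=> Eo; exists (f o).
by case=> a _ [].
Qed.

(** * Nested partitions of the unit interval *)

Section interval_tree.
Context (R : realType) (A : finType) (q : seq A -> R).
Hypothesis q1 : q [::] = 1.
Hypothesis q_ge0 : forall w, 0 <= q w.
Hypothesis q_sum : forall w, \sum_a q (a :: w) = q w.

Let cum (w : seq A) (k : nat) := \sum_(a | (enum_rank a < k)%N) q (a :: w).

(* Words list the digits of a point most recent first, so that the children of
   the cell of [w] are the cells of the words [a :: w]. *)
Fixpoint left_end (w : seq A) : R :=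
  if w is a :: v then
    left_end v + \sum_(b | (enum_rank b < enum_rank a)%N) q (b :: v)
  else 0.

(** Half-open intervals keep siblings disjoint and make the cell of a null word empty. *)
Definition in_cell (w : seq A) (o : R) :=
  (left_end w <= o) && (o < left_end w + q w).

Let cumS w a : cum w (enum_rank a).+1 = cum w (enum_rank a) + q (a :: w).
Proof.
rewrite /cum (bigD1 a) //= addrC; congr (_ + _); apply: eq_bigl => b.
by rewrite ltnS ltn_neqAle andbC (inj_eq val_inj) (inj_eq enum_rank_inj).
Qed.

Let cum_le w j k : (j <= k)%N -> cum w j <= cum w k.
Proof.
move=> jk; rewrite /cum big_mkcond [leRHS]big_mkcond /=; apply: ler_sum => a _.
by case: ifP => [/leq_trans ->//|_]; case: ifP.
Qed.

Let cum_card w : cum w #|A| = q w.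
Proof. by rewrite -q_sum; apply: eq_bigl => a; rewrite ltn_ord. Qed.

Let cum0 w : cum w 0 = 0.
Proof. by rewrite /cum big_pred0. Qed.

Let in_cell_cons a w o : in_cell (a :: w) o =
  (left_end w + cum w (enum_rank a) <= o < left_end w + cum w (enum_rank a).+1).
Proof. by rewrite /in_cell /= cumS addrA. Qed.

Lemma in_cell_parent a w o : in_cell (a :: w) o -> in_cell w o.
Proof.
rewrite in_cell_cons => /andP[h1 h2]; apply/andP; split.
  by apply: le_trans h1; rewrite lerDl sumr_ge0.
by apply: lt_le_trans h2 _; rewrite lerD2l -[leRHS]cum_card cum_le.
Qed.

Lemma in_cell_child w o : in_cell w o -> exists a, in_cell (a :: w) o.
Proof.
move=> /andP[h1 h2].
have ex : exists k, o < left_end w + cum w k by exists #|A|; rewrite cum_card.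
(* The first right end beyond [o] belongs to the child sought: by minimality its left end is at most
   [o]. *)
case: (ex_minnP ex) => -[|k]; first by rewrite cum0 addr0 ltNge h1.
move=> ok kmin; have kA : (k < #|A|)%N by apply: kmin; rewrite cum_card.
exists (enum_val (Ordinal kA)); rewrite in_cell_cons enum_valK ok andbT leNgt.
by apply/negP => /kmin; rewrite ltnn.
Qed.

Lemma in_cell_sibling a b w o :
  in_cell (a :: w) o -> in_cell (b :: w) o -> a = b.
Proof.
rewrite !in_cell_cons => /andP[a1 a2] /andP[b1 b2].
apply/enum_rank_inj/val_inj/eqP; rewrite /= eqn_leq.
apply/andP; split; rewrite leqNgt; apply/negP => h; have := cum_le w h; lra.
Qed.

Let a0_ex : exists a : A, a \in A.
Proof.
apply/existsP; rewrite -[[exists a, _]]negbK negb_exists; apply/negP => /forallP h.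
have := q_sum [::]; rewrite q1 big1 => [/eqP|a]; first by rewrite eq_sym oner_eq0.
by have := h a; rewrite inE.
Qed.

Let a0 : A := xchoose a0_ex.

(** The default only concerns points outside the cell of [w]; along [node] it is reached only
    outside the root cell [[0, 1)]. *)
Definition digit (w : seq A) (o : R) : A :=
  odflt a0 [pick a | in_cell (a :: w) o].

Fixpoint node (n : nat) (o : R) : seq A :=
  if n is k.+1 then digit (node k o) o :: node k o else [::].

Lemma size_node n o : size (node n o) = n.
Proof. by elim: n => //= n ->. Qed.

Let digit_in w a o : in_cell w o -> (digit w o = a <-> in_cell (a :: w) o).
Proof.
move=> wo; rewrite /digit; case: pickP => [b bo|none] /=.
  by split=> [<- //|ao]; exact: in_cell_sibling bo ao.
by have [b] := in_cell_child wo; rewrite none.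
Qed.

Let digit_out w o : ~~ in_cell w o -> digit w o = a0.
Proof.
move=> wo; rewrite /digit; case: pickP => [b bo|none] //=.
by rewrite (in_cell_parent bo) in wo.
Qed.

Lemma node_in_cell w o : in_cell [::] o -> (node (size w) o = w <-> in_cell w o).
Proof.
move=> h01; elim: w => [|a w [IH1 IH2]] //=; split.
  by move=> [da nw]; rewrite nw in da; exact/(digit_in a (IH1 nw)).
move=> ao; have wo := in_cell_parent ao; rewrite (IH2 wo).
by congr cons; exact/digit_in.
Qed.

Lemma in_cell_nil w o : in_cell w o -> in_cell [::] o.
Proof. by elim: w => // a w IH /in_cell_parent. Qed.

Lemma node_out n o : ~~ in_cell [::] o -> node n o = nseq n a0.
Proof.
move=> h01; elim: n => //= n ->; congr cons; apply: digit_out.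
by apply: contra h01; exact: in_cell_nil.
Qed.

Let cell w : set R := [set o | in_cell w o].

Let cellE w : cell w = `[left_end w, left_end w + q w[%classic.
Proof. by apply/seteqP; split => o /=; rewrite in_itv. Qed.

Let measurable_cell w : measurable (cell w : set (measurableTypeR R)).
Proof. by rewrite cellE; exact: measurable_itv. Qed.

Lemma measurable_node w :
  measurable ([set o | node (size w) o = w] : set (measurableTypeR R)).
Proof.
(* Points outside the root cell have only default digits, so they all join the event of the constant
   word. *)
rewrite [X in measurable X](_ : _ = cell w `|`
    (~` cell [::] `&` [set _ | nseq (size w) a0 = w])).
  apply: measurableU => //; apply: measurableI; first exact: measurableC.
  have [h|h] := pselect (nseq (size w) a0 = w).
    by rewrite [X in measurable X](_ : _ = setT) //; apply/seteqP; split.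
  by rewrite [X in measurable X](_ : _ = set0) //; apply/seteqP; split.
apply/seteqP; split => o /=; rewrite /cell /=.
  have [h01|h01] := boolP (in_cell [::] o).
    by move/(node_in_cell _ h01); left.
  by rewrite node_out // => h; right; split => //; exact/negP.
case=> [wo|[/negP h01 h]].
  exact/node_in_cell/wo/(in_cell_nil wo).
by rewrite node_out.
Qed.

Let U : probability (measurableTypeR R) R := uniform_prob (@ltr01 R).

Let U_cell w : U (cell w) = (q w)%:E.
Proof.
have sub : cell w `<=` `[0, 1]%classic.
  move=> o /in_cell_nil; rewrite /in_cell /= q1 add0r in_itv /= => /andP[-> /ltW ->].
  by [].
rewrite /U /= /uniform_prob integral_uniform_pdf setIidl //.
rewrite (eq_integral (fun=> 1%:E)); last first.
  move=> x; rewrite inE => /sub /=; rewrite in_itv /= /uniform_pdf => ->.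
  by rewrite subr0 invr1.
rewrite integral_cst //= mul1e.
rewrite cellE lebesgue_measure_itv /= lte_fin ltrDl.
(* When [q w = 0] the interval is empty and the length formula takes its other branch. *)
case: ltP => [_|qw]; first by rewrite -EFinB addrC addKr.
by congr EFin; apply/eqP; rewrite eq_le q_ge0.
Qed.

(** The event and the cell of [w] differ only outside [[0, 1)], on a null set. *)
Lemma prob_node w : U [set o | node (size w) o = w] = (q w)%:E.
Proof.
have mw := measurable_node w.
have out : U (~` cell [::]) = 0%E.
  by rewrite probability_setC // U_cell q1 subee.
rewrite -U_cell; apply/eqP; rewrite eq_le; apply/andP; split; last first.
  apply: le_measure; rewrite ?inE // => o wo.
  exact/node_in_cell/wo/(in_cell_nil wo).
have : (U [set o | node (size w) o = w] <= U (cell w `|` ~` cell [::]))%E.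
  apply: le_measure; rewrite ?inE //; first by apply: measurableU => //; exact: measurableC.
  move=> o /=; have [h01|/negP h01] := boolP (in_cell [::] o); last by right.
  by move/(node_in_cell _ h01); left.
move/le_trans; apply; rewrite measureU0 //; exact: measurableC.
Qed.

Lemma measurable_digit n a :
  measurable ([set o | digit (node n o) o = a] : set (measurableTypeR R)).
Proof.
rewrite [X in measurable X](_ : _ =
    \bigcup_(w in [set: n.-tuple A]) [set o | node n.+1 o = a :: w]).
  apply: fin_bigcup_measurable => [|w _]; first exact: finite_finset.
  by have := measurable_node (a :: w); rewrite /= size_tuple.
apply/seteqP; split => o /=; last by case=> w _ [].
by move=> da; exists (Tuple (introT eqP (size_node n o))); rewrite //= da.
Qed.

End interval_tree.

Section windows.
Context (R : realType) (A : finType).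
Implicit Type P : process R A.

Lemma window_cons P t n o :
  window (P := P) t n.+1 o = obs (t + 1) o :: window (t + 1) n o.
Proof.
rewrite /window /= -[2%N]addn1 iotaDl -map_comp; congr cons.
by apply: eq_map => i /=; rewrite PoszD addrA.
Qed.

Lemma window_rcons P t n o :
  window (P := P) t n.+1 o = rcons (window t n o) (obs (t + n.+1%:Z) o).
Proof. by rewrite /window -[n.+1 in LHS]addn1 iotaD map_cat cats1 add1n. Qed.

Lemma measurable_window P t w : measurable [set o | window (P := P) t (size w) o = w].
Proof.
elim: w t => [|a w IH] t /=.
  by rewrite [X in measurable X](_ : _ = setT) //; apply/seteqP; split.
rewrite [X in measurable X](_ : _ = obs (t + 1) @^-1` [set a] `&`
    [set o | window (P := P) (t + 1) (size w) o = w]).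
  by apply: measurableI; [exact: obs_measurable|exact: IH].
apply/seteqP; split => o /=; rewrite window_cons; first by move=> [].
by move=> [-> ->].
Qed.

Lemma measurable_obs P t (S : A -> Prop) : measurable [set o | S (obs (p := P) t o)].
Proof.
rewrite [X in measurable X](_ : _ =
    \bigcup_(a in [set a | S a]) (obs t @^-1` [set a])).
  apply: fin_bigcup_measurable => [|a _]; first exact: finite_finset.
  exact: obs_measurable.
by apply/seteqP; split => o /=; [exists (obs t o)|case=> a /= ? ->].
Qed.

Lemma law_window_split P t (E : set (sample P)) : measurable E ->
  law P E = (\sum_a law P (E `&` obs t @^-1` [set a]))%E.
Proof. by apply: measure_fibers => a; exact: obs_measurable. Qed.

End windows.

(** * Two-sided process from consistent word probabilities *)

Section two_sided.
Context (R : realType) (A : finType) (Q : seq A -> R).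
Hypothesis Q1 : Q [::] = 1.
Hypothesis Q_ge0 : forall w, 0 <= Q w.
Hypothesis Q_left : forall w, \sum_a Q (a :: w) = Q w.
Hypothesis Q_right : forall w, \sum_a Q (rcons w a) = Q w.

(* [(a_k, b_k) :: ... :: (a_1, b_1)] stands for [a_k ... a_1 b_1 ... b_k],
   where [a_1], [b_1] are at times 0 and 1 *)
Fixpoint unfold_pairs (z : seq (A * A)) : seq A :=
  if z is (a, b) :: z' then a :: rcons (unfold_pairs z') b else [::].

Lemma unfold_pairs_inj : injective unfold_pairs.
Proof.
elim=> [|[a b] z IH] [|[a' b'] z'] //= [-> /rcons_inj[zz' ->]].
by rewrite (IH _ zz').
Qed.

Lemma unfold_pairs_surj k w : size w = k.*2 ->
  exists2 z, size z = k & unfold_pairs z = w.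
Proof.
elim: k w => [|k IH] w.
  by rewrite double0 => /size0nil ->; exists [::].
case: w => // a w; rewrite doubleS /= => -[].
case/lastP: w => // w b; rewrite size_rcons => -[/IH[z zk <-]].
by exists ((a, b) :: z); rewrite /= ?zk.
Qed.

Let q z := Q (unfold_pairs z).

(** One level of the tree adds a letter at each end of the block, so its consistency combines
    [Q_left] and [Q_right]. *)
Let q_sum z : \sum_ab q (ab :: z) = q z.
Proof.
rewrite /q (eq_bigr (fun ab => Q (ab.1 :: rcons (unfold_pairs z) ab.2))); last first.
  by case.
rewrite -(pair_bigA _ (fun a b => Q (a :: rcons (unfold_pairs z) b))) /=.
by rewrite exchange_big -[RHS]Q_right; apply: eq_bigr => b _; exact: Q_left.
Qed.

Let nd := node (q := q) Q1 q_sum.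
Let dg := digit (q := q) Q1 q_sum.

(** The digit at depth [n] carries the letters at times [-n] and [n + 1]. *)
Let letter (t : int) (o : measurableTypeR R) : A :=
  match t with
  | Posz 0 => (dg (nd 0 o) o).1
  | Posz n.+1 => (dg (nd n o) o).2
  | Negz n => (dg (nd n.+1 o) o).1
  end.

Let measurable_letter t a : measurable (letter t @^-1` [set a]).
Proof.
have m n (S : A * A -> Prop) : measurable [set o : measurableTypeR R | S (dg (nd n o) o)].
  rewrite [X in measurable X](_ : _ =
      \bigcup_(ab in [set ab | S ab]) [set o | dg (nd n o) o = ab]).
    apply: fin_bigcup_measurable => [|ab _]; first exact: finite_finset.
    exact: (@measurable_digit R _ q Q1 (fun z => Q_ge0 (unfold_pairs z)) q_sum).
  by apply/seteqP; split => o /=; [exists (dg (nd n o) o)|case=> ab /= ? ->].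
case: t => [[|n]|n] /=.
- exact: (m 0%N (fun ab => ab.1 = a)).
- exact: (m n (fun ab => ab.2 = a)).
- exact: (m n.+1 (fun ab => ab.1 = a)).
Qed.

Let two_sided : process R A :=
  @Process R A _ (measurableTypeR R) (uniform_prob (@ltr01 R)) letter measurable_letter.

Let window_node k o :
  window (P := two_sided) (- k%:Z) k.*2 o = unfold_pairs (nd k o).
Proof.
elim: k => [|k IH]; first by [].
rewrite doubleS window_cons window_rcons.
rewrite (_ : - k.+1%:Z + 1 = - k%:Z); last by lia.
rewrite (_ : - k%:Z + k.*2.+1%:Z = k.+1%:Z); last by lia.
rewrite IH -[nd k.+1 o]/(dg (nd k o) o :: nd k o) /=.
case E : (dg (nd k o) o) => [a b] /=; congr (_ :: _).
by case: (k) E => [|n] /= ->.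
Qed.

Let law_determined t n := forall w, size w = n ->
  law two_sided [set o | window t n o = w] = (Q w)%:E.

Let law_determined_center k : law_determined (- k%:Z) k.*2.
Proof.
move=> w /unfold_pairs_surj[z zk <-].
rewrite -[RHS](prob_node Q1 (fun z => Q_ge0 (unfold_pairs z)) q_sum z) zk.
congr (uniform_prob _ _); apply/seteqP; split => o /=; rewrite window_node.
  by move/unfold_pairs_inj.
by move=> <-.
Qed.

Let law_determined_tail t n : law_determined t n.+1 -> law_determined (t + 1) n.
Proof.
move=> H w wn; rewrite (law_window_split (t + 1)); last first.
  by rewrite -wn; exact: measurable_window.
rewrite -Q_left -sumEFin; apply: eq_bigr => a _; rewrite -H /= ?wn //.
apply: congr1; apply/seteqP; split => o /=; rewrite window_cons;
  by move=> [<- <-].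
Qed.

Let law_determined_init t n : law_determined t n.+1 -> law_determined t n.
Proof.
move=> H w wn; rewrite (law_window_split (t + n.+1%:Z)); last first.
  by rewrite -wn; exact: measurable_window.
rewrite -Q_right -sumEFin; apply: eq_bigr => a _; rewrite -H ?size_rcons ?wn //.
apply: congr1; apply/seteqP; split => o /=; rewrite window_rcons.
  by move=> [<- <-].
by move/rcons_inj => [<- <-].
Qed.

Lemma two_sided_process : exists P : process R A,
  forall t w, law P [set o | window t (size w) o = w] = (Q w)%:E.
Proof.
exists two_sided => t w.
have drop_left i n s : law_determined s (i + n) -> law_determined (s + i%:Z) n.
  elim: i s => [|i IH] s; first by rewrite addr0.
  by move/law_determined_tail/IH; rewrite -addrA.
have drop_right i n s : law_determined s (n + i) -> law_determined s n.
  by elim: i => [|i IH]; rewrite ?addn0 ?addnS // => /law_determined_init/IH.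
(* The centred window over times [1 - k] to [k] contains the requested one; [i] counts the letters
   to drop on its left. *)
pose k := (`|t|%N + size w)%N; pose i := `|(k%:Z + t)%R|%N.
have ti : t = - k%:Z + i%:Z by rewrite /i /k; lia.
suff : law_determined t (size w) by exact.
rewrite ti; apply: drop_left; apply: (drop_right (k.*2 - (i + size w))%N).
rewrite subnKC; first exact: law_determined_center.
by rewrite /i /k; lia.
Qed.

End two_sided.

(** * Words emitted by a machine *)

Section machine.
Context (R : realType) (X : finType) (G : emachine R X).
Implicit Types (s t : state G) (x : X) (w : seq X).

Lemma emit_ge0 s x : 0 <= emit s x.
Proof. by have [+ _] := emit_pmf s; apply. Qed.

Lemma init_ge0 s : 0 <= init s.
Proof. by have [+ _] := init_prob G; apply. Qed.

Lemma emit_inadmissible s x : next s x = None -> emit s x = 0.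
Proof.
move=> sx; have := next_dom s x; rewrite sx /= => /esym/negbT.
by rewrite -leNgt => e0; apply/eqP; rewrite eq_le e0 emit_ge0.
Qed.

(** Some state has positive mass, and invariance carries positivity along every admissible edge. *)
Lemma init_gt0 s : 0 < init s.
Proof.
have [t t0] : exists t, 0 < init t.
  apply/existsP; apply: contraT => /existsPn h.
  have [_] := init_prob G; rewrite big1 => [/eqP|t _].
    by rewrite eq_sym oner_eq0.
  by apply/eqP; rewrite eq_le init_ge0 andbT leNgt h.
have /connectP[r + ->] := strongly_connected t s.
elim: r t t0 => //= a r IH t t0 /andP[/existsP[x /eqP tx]]; apply: IH.
rewrite -(init_inv a) (bigD1 t) //= ltr_pwDl //.
  rewrite mulr_gt0 // /transition (bigD1 x) ?tx //= ltr_pwDl -?next_dom ?tx //.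
  by apply: sumr_ge0 => *; exact: emit_ge0.
apply: sumr_ge0 => *; rewrite mulr_ge0 ?init_ge0 //.
by apply: sumr_ge0 => *; exact: emit_ge0.
Qed.

(** State and symbol determine the successor, so at most one pair per symbol contributes. *)
Lemma sum_steps s (F : state G * X -> R) :
  \sum_tx (if next s tx.2 == Some tx.1 then emit s tx.2 else 0) * F tx =
  \sum_x (if next s x is Some t then emit s x * F (t, x) else 0).
Proof.
pose f t x := (if next s x == Some t then emit s x else 0) * F (t, x).
rewrite (eq_bigr (fun tx => f tx.1 tx.2)) => [|[] //].
rewrite -(pair_bigA _ f) exchange_big; apply: eq_bigr => x _; rewrite /f /=.
case E : (next s x) => [t|]; last by rewrite big1 // => t _; rewrite mul0r.
rewrite (bigD1 t) //= eqxx big1 ?addr0 // => t' tt'.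
by rewrite (inj_eq Some_inj) eq_sym (negbTE tt') mul0r.
Qed.

Lemma sum_path_rcons s z : \sum_tx path_prob s (rcons z tx) = path_prob s z.
Proof.
elim: z s => [|[t x] z IH] s /=; last by rewrite -mulr_sumr IH.
rewrite (eq_bigr (fun tx =>
    (if next s tx.2 == Some tx.1 then emit s tx.2 else 0) * 1)); last first.
  by case=> t x; rewrite /= mulr1.
rewrite sum_steps -[RHS](emit_pmf s).2; apply: eq_bigr => x _.
by case E : (next s x) => [t|]; rewrite ?mulr1 // emit_inadmissible.
Qed.

(** The state before the first pair is averaged out, so that these are block laws of the pairs
    alone, as the two-sided construction requires. *)
Definition path_law (z : seq (state G * X)) : R := \sum_s init s * path_prob s z.

Lemma sum_path_law_symbol t z :
  \sum_x path_law ((t, x) :: z) = init t * path_prob t z.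
Proof.
rewrite exchange_big /= -[in RHS](init_inv t) mulr_suml; apply: eq_bigr => s _.
rewrite -mulr_sumr -mulrA -mulr_suml; congr (_ * (_ * _)).
by rewrite /transition [RHS]big_mkcond.
Qed.

Lemma sum_path_law_cons z : \sum_tx path_law (tx :: z) = path_law z.
Proof.
rewrite (eq_bigr (fun tx => path_law ((tx.1, tx.2) :: z))); last by case.
rewrite -(pair_bigA _ (fun t x => path_law ((t, x) :: z))) /=.
by apply: eq_bigr => t _; exact: sum_path_law_symbol.
Qed.

Lemma sum_path_law_rcons z : \sum_tx path_law (rcons z tx) = path_law z.
Proof.
rewrite exchange_big; apply: eq_bigr => s _.
by rewrite -mulr_sumr sum_path_rcons.
Qed.

Lemma path_law_nil : path_law [::] = 1.
Proof.
by have [_ <-] := init_prob G; apply: eq_bigr => s _; rewrite mulr1.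
Qed.

Lemma path_law_ge0 z : 0 <= path_law z.
Proof.
apply: sumr_ge0 => s _; rewrite mulr_ge0 ?init_ge0 //.
elim: z s => [|[t x] z IH] s //=; rewrite mulr_ge0 //.
by case: ifP => // _; exact: emit_ge0.
Qed.

(** The state at time [k] belongs to the pair at time [k]: splitting over the symbol of that pair
    gives windows that start one step earlier. *)
Lemma path_law_machine_process (J : process R (state G * X)%type) :
  (forall (k : int) z, law J [set o | window k (size z) o = z] = (path_law z)%:E) ->
  machine_process J.
Proof.
move=> lawJ /= k s z; rewrite (measure_fibers (law J) (f := fun o => (obs k o).2)).
- rewrite -sum_path_law_symbol -sumEFin; apply: eq_bigr => x _.
  rewrite -(lawJ (k - 1)).
  apply: congr1; apply/seteqP; split => o /=; rewrite window_cons subrK.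
    by move=> [[<- ->] <-]; case: (obs k o).
  by move=> [-> ->].
- by move=> x; exact: (@measurable_obs _ _ J k (fun a => a.2 = x)).
- apply: measurableI; last exact: measurable_window.
  exact: (@measurable_obs _ _ J k (fun a => a.1 = s)).
Qed.

Lemma generates_exists : exists P : process R X, generates G P.
Proof.
have [J lawJ] := two_sided_process path_law_nil path_law_ge0 sum_path_law_cons
  sum_path_law_rcons.
exists (@Process R X _ _ (law J) (fun k o => (obs (p := J) k o).2)
  (fun k x => @measurable_obs _ _ J k (fun a => a.2 = x))).
exists J; first exact: path_law_machine_process lawJ.
by move=> k w; apply: congr1; apply/seteqP; split => o /=;
  rewrite /window -map_comp.
Qed.

Lemma measurable_observed (J : process R (state G * X)%type) (k : int) w :
  measurable [set o | map snd (window (P := J) k (size w) o) = w].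
Proof.
elim: w k => [|x w IH] k.
  by rewrite [Y in measurable Y](_ : _ = setT) //; apply/seteqP; split.
rewrite [Y in measurable Y](_ : _ = [set o | (obs (p := J) (k + 1) o).2 = x] `&`
    [set o | map snd (window (P := J) (k + 1) (size w) o) = w]).
  apply: measurableI; last exact: IH.
  exact: (@measurable_obs _ _ J _ (fun a => a.2 = x)).
apply/seteqP; split => o; rewrite /mkset /setI /mkset window_cons map_cons.
  by move=> [].
by move=> [-> ->].
Qed.

Lemma path_prob_rcons s z tx : path_prob s (rcons z tx) = path_prob s z *
  (if next (last s (map fst z)) tx.2 == Some tx.1
   then emit (last s (map fst z)) tx.2 else 0).
Proof.
elim: z s => [|[t x] z IH] s /=; last by rewrite IH mulrA.
by case: tx => t x; rewrite mul1r mulr1.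
Qed.

(* The states along [z] are kept in the event because prepending a symbol to [w]
   is resolved by appending a state to [z]. *)
Lemma machine_law_observed (J : process R (state G * X)%type) (k : int) s z w :
  machine_process J ->
  law J [set o | [/\ (obs k o).1 = s, window k (size z) o = z &
    map snd (window (k + (size z)%:Z) (size w) o) = w]] =
  (init s * path_prob s z * wprob (last s (map fst z)) w)%:E.
Proof.
move=> lawJ; elim: w z => [|x w IH] z.
  rewrite mulr1 -(lawJ k); apply: congr1; apply/seteqP; split => o /=;
    by case.
rewrite (law_window_split (k + (size z)%:Z + 1)); last first.
  rewrite [Y in measurable Y](_ : _ =
    [set o | (obs (p := J) k o).1 = s] `&` [set o | window (P := J) k (size z) o = z] `&`
    [set o | map snd (window (P := J) (k + (size z)%:Z) (size (x :: w)) o) = x :: w]).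
    apply: measurableI; last exact: measurable_observed.
    apply: measurableI; last exact: measurable_window.
    exact: (@measurable_obs _ _ J k (fun a => a.1 = s)).
  by apply/seteqP; split => o /=; [case|case=> -[]].
set l := last s _.
pose F (tx : state G * X) := if tx.2 == x then wprob tx.1 w else 0.
rewrite (eq_bigr (fun tx => (init s * path_prob s z *
    ((if next l tx.2 == Some tx.1 then emit l tx.2 else 0) * F tx))%:E)); last first.
  move=> [t y] _; rewrite /F [(t, y).2]/= [(t, y).1]/=.
  have [->|yx] := eqVneq y x; last first.
    rewrite !mulr0 [Y in law J Y](_ : _ = set0) ?measure0 //.
    apply/seteqP; split => o //; rewrite /setI /mkset.
    rewrite window_cons /= => -[[_ _ [+ _]] oty].
    by rewrite oty /= => yx'; rewrite yx' eqxx in yx.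
  (* The symbol [x] leaves the observed word and joins [z] together with the state it leads to. *)
  have := IH (rcons z (t, x)).
  rewrite path_prob_rcons map_rcons last_rcons -/l [(t, x).2]/= [(t, x).1]/=.
  rewrite !mulrA => <-; apply: congr1; apply/seteqP; split => o; rewrite /setI /mkset.
    rewrite window_cons /= => -[[-> wz [_ ww]] ot].
    by split=> //; rewrite size_rcons ?window_rcons ?wz -addn1 PoszD addrA // ot.
  rewrite size_rcons window_rcons -addn1 PoszD addrA window_cons /=.
  by move=> [os /rcons_inj[wz ->] ww]; split => //; split; rewrite //= ww.
rewrite sumEFin -mulr_sumr sum_steps /F /=; congr (_ * _)%:E.
rewrite (bigD1 x) //= big1 ?addr0 => [|y yx]; rewrite ?eqxx //.
by rewrite (negbTE yx); case: (next l y) => // t; rewrite mulr0.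
Qed.

Lemma generates_block_prob (P : process R X) (k : int) w :
  generates G P -> block_prob P k w = machine_word G w.
Proof.
move=> [J lawJ PJ]; rewrite /block_prob PJ.
rewrite (measure_fibers (law J) (f := fun o => (obs k o).1)); last 2 first.
- by move=> s; exact: (@measurable_obs _ _ J k (fun a => a.1 = s)).
- exact: measurable_observed.
rewrite (eq_bigr (fun s => (init s * wprob s w)%:E)) ?sumEFin // => s _.
have := machine_law_observed k s [::] w lawJ; rewrite /= mulr1 => <-.
apply: congr1; apply/seteqP; split => o /=; rewrite addr0;
  by case.
Qed.

Lemma generates_word_law (P : process R X) w :
  generates G P -> word_law P w = machine_word G w.
Proof. exact: generates_block_prob. Qed.

Lemma generates_stationary (P : process R X) : generates G P -> stationary P.
Proof. by move=> GP k k' w; rewrite !(generates_block_prob _ _ GP). Qed.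

Lemma wprob_cat s u w : wprob s (u ++ w) =
  if run (@Defs.next R X G) s u is Some t
  then wprob (G := G) s u * wprob (G := G) t w else 0.
Proof.
elim: u s => [|x u IH] s; first by rewrite /= mul1r.
rewrite /wprob /=; case: (next s x) => //= t; rewrite -/(wprob t _) IH.
by case: run => [t'|]; rewrite ?mulr0 // mulrA.
Qed.

(** Splitting by the state reached after [u] factors the Hankel matrix through the state set. *)
Lemma machine_word_cat u w :
  machine_word G (u ++ w) = \sum_(t : state G) machine_word_state u t * wprob t w.
Proof.
under [RHS]eq_bigr => t _ do rewrite mulr_suml big_mkcond.
rewrite exchange_big; apply: eq_bigr => s _; rewrite wprob_cat.
case: run => [t|]; last by rewrite mulr0 big1.
rewrite (bigD1 t) //= eqxx big1 ?addr0 ?mulrA // => t' tt'.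
by rewrite (inj_eq Some_inj) eq_sym (negbTE tt').
Qed.

Lemma hankel_rank_le (P : process R X) :
  generates G P -> (hankel_rank P <= (#|state G|%:R)%:E)%E.
Proof.
move=> GP; apply: ge_ereal_sup => _ [k [l [u [v ->]]]].
rewrite lee_fin ler_nat.
pose A := \matrix_(i < k, j < #|state G|) machine_word_state (u i) (enum_val j).
pose B := \matrix_(i < #|state G|, j < l) wprob (enum_val i) (v j).
rewrite (_ : \matrix_(i, j) _ = A *m B) ?mulmx_max_rank //.
apply/matrixP => i j; rewrite !mxE /hankel generates_word_law // machine_word_cat.
rewrite (reindex _ (onW_bij _ (@enum_val_bij (state G)))).
by apply: eq_bigr => t _; rewrite !mxE.
Qed.

Lemma isomorphic_word (G' : emachine R X) :
  isomorphic G G' -> machine_word G =1 machine_word G'.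
Proof.
move=> [f [fbij finit femit fnext]] w.
rewrite /machine_word [RHS](reindex f (onW_bij _ fbij)); apply: eq_bigr => s _.
rewrite finit; congr (_ * _).
elim: w s => //= x w IH s; rewrite /wprob /=.
case E : (next s x) => [t|].
  by rewrite fnext -?next_dom E //= femit -/(wprob t w) IH.
(* An inadmissible symbol stays so under [f], because the emissions decide where [next] is
   defined. *)
case E' : (Defs.next (f s) x) => [t|] //.
by have := next_dom (f s) x; rewrite E' femit -next_dom E.
Qed.

End machine.

Section machine_words.
Context (R : realType) (X : finType) (G : emachine R X).
Implicit Types (s t : state G) (x : X) (w : seq X).

Lemma run_rcons s w x :
  run (@next R X G) s (rcons w x) = obind (fun t => next t x) (run (@next R X G) s w).
Proof.
elim: w s => [|y w IH] s /=; first by case: (next s x).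
by case: (next s y) => //= t; rewrite IH.
Qed.

Lemma machine_word_state_rcons w x t :
  machine_word_state (rcons w x) t =
  \sum_(s | next s x == Some t) machine_word_state w s * emit s x.
Proof.
rewrite /machine_word_state.
under [RHS]eq_bigr => s _ do rewrite mulr_suml big_mkcond.
rewrite exchange_big /= big_mkcond; apply: eq_bigr => s _.
rewrite run_rcons -cats1 wprob_cat; case: run => [t'|] /=; last by rewrite big1.
rewrite big_mkcond (bigD1 t') //= eqxx big1 ?addr0 => [|s' ne]; last first.
  by case: ifP => // _; case: eqP => // -[e]; rewrite e eqxx in ne.
by rewrite /wprob /=; case: (next t' x) => [t''|] //=; rewrite mulr1 mulrA.
Qed.

Lemma machine_word_sum w : machine_word G w = \sum_(t : state G) machine_word_state w t.
Proof.
by rewrite -[w in LHS]cats0 machine_word_cat; apply: eq_bigr => t _; rewrite mulr1.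
Qed.

Lemma machine_word_state_ge0 w t : 0 <= machine_word_state w t.
Proof.
apply: sumr_ge0 => s _; rewrite mulr_ge0 ?init_ge0 // /wprob.
elim: w s => //= x w IH s; case: (next s x) => // t'.
by rewrite mulr_ge0 ?emit_ge0.
Qed.

End machine_words.

(** * Context machines *)

Section predecessors.
Context (m : nat).
Implicit Types (v : m.-tuple bool) (x b : bool).

Lemma context_next_cons b v x : context_next [tuple of b :: v] x = [tuple of rcons v x].
Proof. exact: val_inj. Qed.

Lemma sum_predecessors (R : realType) v x (F : m.+1.-tuple bool -> R) :
  \sum_(s | context_next s x == [tuple of rcons v x]) F s =
  F [tuple of true :: v] + F [tuple of false :: v].
Proof.
rewrite (bigD1 [tuple of true :: v]) /= ?context_next_cons //; congr (_ + _).
rewrite (bigD1 [tuple of false :: v]) /= ?context_next_cons ?eqxx //.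
rewrite big1 ?addr0 // => s; case/tupleP: s => b u; rewrite context_next_cons.
move=> /andP[/andP[/eqP /(congr1 val) /= /rcons_inj[/val_inj ->]]].
by case: b; rewrite eqxx.
Qed.

End predecessors.

Section context.
Context (R : realType) (m : nat) (p : m.+1.-tuple bool -> R).
Hypotheses (p_bound : forall u, 0 < p u < 1) (p_inj : injective p).

Let G := context_machine p_bound p_inj.

(** A transition into a context ending with [x] must emit [x], so only that symbol contributes to
    the invariance equation. *)
Lemma context_init_predecessors (v : m.-tuple bool) x :
  init (e := G) [tuple of rcons v x] =
  \sum_(s : state G | next s x == Some [tuple of rcons v x]) init s * emit s x.
Proof.
rewrite -[LHS](init_inv (e := G)) [RHS]big_mkcond; apply: eq_bigr => s _ /=.
rewrite /transition; case/tupleP: s => b u; rewrite context_next_cons.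
have E y : (Some [tuple of rcons u y] == Some [tuple of rcons v x]) =
    (y == x) && (u == v).
  rewrite (inj_eq Some_inj) -val_eqE /= eqseq_rcons andbC.
  by rewrite val_eqE.
rewrite (eq_bigl (fun y => (y == x) && (u == v))) ?E ?eqxx /=; last first.
  by move=> y; rewrite /= context_next_cons E.
have [->|_] := eqVneq u v; last by rewrite big_pred0 ?mulr0 // => y; rewrite andbF.
by rewrite (big_pred1 x) // => y; rewrite andbT.
Qed.

(** Induction on the last letter: the predecessors of [t] share the indicator, and when it is 1 the
    context [t] ends with the letter read, so invariance sums them to [init t]. *)
Lemma context_word_state w (t : state G) : (size w <= m.+1)%N ->
  machine_word_state w t = (drop (m.+1 - size w) t == w)%:R * init t.
Proof.
elim/last_ind: w t => [|w x IH] t /=.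
  rewrite subn0 drop_oversize ?size_tuple // eqxx mul1r => _.
  by rewrite /machine_word_state /= big_pred1_eq mulr1.
rewrite size_rcons => wm; rewrite machine_word_state_rcons.
transitivity (\sum_(s : state G | next s x == Some t)
    (drop (m.+1 - (size w).+1) t == rcons w x)%:R * (init s * emit s x)).
  apply: eq_bigr => s /eqP [<-]; rewrite IH ?(ltnW wm) // mulrA.
  congr (_%:R * _ * _); rewrite /= -[behead _]drop1 drop_drop addn1 -subSn // subSS.
  by rewrite drop_rcons ?size_tuple ?leq_subr // eqseq_rcons eqxx andbT.
rewrite -mulr_sumr; case: eqP => [tw|_]; last by rewrite !mul0r.
congr (_ * _).
have tE : val t = rcons (take (m.+1 - (size w).+1) t ++ w) x.
  by rewrite rcons_cat -tw cat_take_drop.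
have vm : size (take (m.+1 - (size w).+1) t ++ w) == m.
  by have := congr1 size tE; rewrite size_tuple size_rcons => -[<-].
have -> : t = [tuple of rcons (Tuple vm) x] by exact: val_inj.
exact/esym/context_init_predecessors.
Qed.

Lemma context_state_word (t u : state G) :
  machine_word_state (val u) t = (t == u)%:R * init t.
Proof. by rewrite context_word_state size_tuple // subnn drop0 val_eqE. Qed.

Lemma context_word (u : state G) w :
  machine_word G (val u ++ w) = init u * wprob u w.
Proof.
rewrite machine_word_cat (bigD1 u) //= context_state_word eqxx mul1r big1 ?addr0 //.
by move=> t tu; rewrite context_state_word (negbTE tu) !mul0r.
Qed.

Lemma context_synchronizes (u : state G) : synchronizes (val u) u.
Proof.
rewrite /synchronizes -[X in machine_word G X]cats0 context_word mulr1.
by rewrite context_state_word eqxx mul1r init_gt0 divff // gt_eqF // init_gt0.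
Qed.

(** A shorter word leaves the first letter of the context free, and flipping that letter gives a
    second possible state. *)
Lemma context_synchronizing_size (u : state G) w :
  synchronizes w u -> (m.+1 <= size w)%N.
Proof.
case=> w0 wu; rewrite leqNgt; apply/negP => wm.
have {wu} : machine_word_state w u = machine_word G w.
  by rewrite -[LHS](divfK (lt0r_neq0 w0)) wu mul1r.
(* All the mass of [w] sits at [u], so the weights of the other states sum to 0. *)
have := w0; rewrite machine_word_sum (bigD1 u) //= => h /eqP.
rewrite -subr_eq0 opprD addNKr oppr_eq0 => /eqP S0; move: h; rewrite S0 addr0.
rewrite context_word_state ?(ltnW wm) //; case: eqP => [uw _|]; last by rewrite mul0r ltxx.
case/tupleP: u S0 uw => b v S0 uw.
pose u : state G := [tuple of ~~ b :: v].
have : machine_word_state w u = 0.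
  apply: (psumr_eq0P _ S0) => [t _|]; first exact: machine_word_state_ge0.
  by rewrite -val_eqE /= eqseq_cons; case: (b).
have uw' : drop (m.+1 - size w) u = w.
  by move: uw; rewrite subSn //; exact.
rewrite context_word_state ?(ltnW wm) // uw' eqxx mul1r => /eqP.
by rewrite gt_eqF // init_gt0.
Qed.

Lemma context_L_tar : L_tar G = (m.+1%:R)%:E.
Proof.
rewrite /L_tar (eq_bigr (fun=> (m.+1%:R)%:E)) => [|u _]; last first.
  apply/eqP; rewrite eq_le; apply/andP; split.
    apply: ereal_inf_lbound; exists (val u); first exact: context_synchronizes.
    by rewrite size_tuple.
  apply: le_ereal_inf_tmp => _ [w /context_synchronizing_size wm <-].
  by rewrite lee_fin ler_nat.
apply/eqP; rewrite eq_le; apply/andP; split.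
  by apply: bigmax_le => // *; rewrite lee_fin.
exact: (le_bigmax_cond _ (fun=> (m.+1%:R)%:E) (j := nseq_tuple m.+1 false : state G)).
Qed.

Lemma context_L_sep : L_sep G = 1%:E.
Proof.
rewrite /L_sep (eq_bigr (fun=> 1%:E)) => [|[u v] /= uv]; last first.
  apply/eqP; rewrite eq_le; apply/andP; split.
    apply: ereal_inf_lbound; exists [:: true] => //=.
    by rewrite /wprob /= !mulr1 /context_emit (inj_eq p_inj).
  apply: le_ereal_inf_tmp => _ [[|x w] /= + <-]; first by rewrite eqxx.
  by rewrite lee_fin ler1n.
apply/eqP; rewrite eq_le; apply/andP; split.
  by apply: bigmax_le => // *; rewrite lee_fin.
(* The two constant contexts differ because the order is positive, so the maximum is over a nonempty
   set. *)
pose u b : state G := nseq_tuple m.+1 b.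
by apply: (le_bigmax_cond _ (fun=> 1%:E) (j := (u true, u false))).
Qed.

Lemma wprob_context_cons (s : state G) x w :
  wprob s (x :: w) = context_emit p s x * wprob (context_next s x : state G) w.
Proof. by []. Qed.

(* A left-kernel vector of the matrix [p_u(v)] is pushed through one symbol; after
   [m + 1] symbols all its weight sits on the single state reached. *)
Definition weight_step (c : m.+1.-tuple bool -> R) x t :=
  \sum_(s | context_next s x == t) c s * context_emit p s x.

Definition weight_run (c : m.+1.-tuple bool -> R) (w : seq bool) :=
  foldl weight_step c w.

Lemma weight_step_eq0 c : (forall x t, weight_step c x t = 0) -> c =1 (fun=> 0).
Proof.
move=> c0 s; case/tupleP: s => b v.
have := c0 true [tuple of rcons v true]; have := c0 false [tuple of rcons v false].
rewrite /weight_step !sum_predecessors /context_emit.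
set u1 := [tuple of _]; set u2 := [tuple of _] => e0 e1.
have pu : p u1 - p u2 != 0.
  by rewrite subr_eq0 (inj_eq p_inj) -val_eqE.
have c1 : c u1 = 0.
  apply/eqP; rewrite -[_ == 0]orbF -(negbTE pu) -mulf_eq0; apply/eqP.
  (* This is the sum of [e0] and [e1]; substituting it in [e1] leaves [c u1 * (p u1 - p u2) = 0]. *)
  have c12 : c u2 = - c u1 by lra.
  by rewrite c12 in e1; rewrite -[RHS]e1; ring.
have c2 : c u2 = 0 by rewrite c1 !mul0r !add0r in e0 e1; lra.
by case: b.
Qed.

Lemma weight_run_eq0 n c :
  (forall w t, size w = n -> weight_run c w t = 0) -> c =1 (fun=> 0).
Proof.
elim: n c => [|n IH] c c0; first by move=> s; exact: (c0 [::]).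
apply: weight_step_eq0 => x; apply: IH => w t wn.
by rewrite -(c0 (x :: w) t) //= wn.
Qed.

Lemma weight_runE c w t : weight_run c w t =
  \sum_(s : state G | foldl (@context_next m.+1) s w == t) c s * wprob s w.
Proof.
elim: w c => [|x w IH] c; first by rewrite /= big_pred1_eq mulr1.
rewrite /= IH [RHS](partition_big (fun s => context_next s x)
    (fun s => foldl (@context_next m.+1) s w == t)) //=.
apply: eq_bigr => u ut; rewrite /weight_step mulr_suml.
rewrite [RHS](eq_bigl (fun s => context_next s x == u)) => [|s]; last first.
  by have [e|_] := eqVneq (context_next s x) u; rewrite ?andbF // andbT e.
by apply: eq_bigr => s /eqP <-; rewrite wprob_context_cons mulrA.
Qed.

Lemma wprob_context_free (c : state G -> R) :
  (forall u : state G, \sum_s c s * wprob s (val u) = 0) -> c =1 (fun=> 0).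
Proof.
move=> c0; apply: (@weight_run_eq0 m.+1) => w t wm; rewrite weight_runE.
have [u uw] : exists u : state G, val u = w by exists (Tuple (introT eqP wm)).
have end_w (s : state G) : foldl (@context_next m.+1) s w = u.
  by apply: val_inj; rewrite context_foldl uw drop_size_cat // size_tuple.
under eq_bigl => s do rewrite end_w.
(* Every state has become [u], so the sum is either empty or the hypothesis at [u]. *)
by case: eqP => [_|_]; rewrite ?big_pred0_eq // -uw; exact: c0.
Qed.

Lemma context_hankel_rank (P : process R bool) :
  generates G P -> hankel_rank P = (2 ^+ m.+1)%:E.
Proof.
move=> GP; apply/eqP; rewrite eq_le; apply/andP; split.
  by have := hankel_rank_le GP; rewrite card_tuple card_bool natrX.
(* The square submatrix on the words of length [m + 1] already has full rank. *)
pose u (i : 'I_#|state G|) : seq bool := val (enum_val i).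
apply: ereal_sup_ubound; exists #|state G|, #|state G|, u, u.
suff /eqP -> : row_free (\matrix_(i < #|state G|, j < #|state G|) hankel P (u i) (u j)).
  by rewrite card_tuple card_bool natrX.
apply: inj_row_free => r rH; apply/rowP => i; rewrite mxE.
(* The row of [s] is [init s] times the word probabilities from [s]; the positive factor is moved
   into the kernel vector. *)
pose c (s : state G) := r 0 (enum_rank s) * init s.
have : c (enum_val i) = 0.
  apply: wprob_context_free => t; have /rowP/(_ (enum_rank t)) := rH; rewrite !mxE => E.
  rewrite -[RHS]E.
  rewrite [RHS](reindex _ (onW_bij _ (@enum_rank_bij (state G)))); apply: eq_bigr => s _.
  rewrite !mxE /hankel (generates_word_law _ GP) /u !enum_rankK context_word.
  by rewrite mulrA.
move=> /eqP; rewrite /c enum_valK mulf_eq0 => /orP[/eqP //|].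
by rewrite gt_eqF // init_gt0.
Qed.

End context.

(** * Context machines with uniform stationary law *)

Section balanced.
Context (R : realType) (m : nat).

Lemma context_presents (p : m.+1.-tuple bool -> R) (p_bound : forall u, 0 < p u < 1)
    (p_inj : injective p) (P : process R bool) :
  generates (context_machine p_bound p_inj) P ->
  presents m.+1 1 (context_machine p_bound p_inj) P.
Proof.
move=> GP; split => //; last 2 first.
- by rewrite context_L_tar.
- by rewrite context_L_sep.
pose u : state (context_machine p_bound p_inj) := nseq_tuple m.+1 false.
by exists (val u), u; exact: context_synchronizes.
Qed.

Lemma balanced_init (p : m.+1.-tuple bool -> R) (p_bound : forall u, 0 < p u < 1)
    (p_inj : injective p) :
  (forall v : m.-tuple bool, p [tuple of true :: v] + p [tuple of false :: v] = 1) ->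
  init (e := context_machine p_bound p_inj) =1 (fun=> 2^-1 ^+ m.+1).
Proof.
move=> p1 s; apply/esym/(init_unique (e := context_machine p_bound p_inj)).
  split=> [t|]; first by rewrite exprn_ge0 // invr_ge0.
  rewrite sumr_const card_tuple card_bool -[LHS]mulr_natr natrX -exprMn.
  by rewrite mulVf ?expr1n ?pnatr_eq0.
move=> t; rewrite -mulr_sumr.
(* The transition matrix is doubly stochastic: [rcons v x] is entered from [true :: v] and
   [false :: v], whose probabilities of emitting [x] add up to 1. *)
have -> : \sum_(s : m.+1.-tuple bool) transition (@emit _ _ (context_machine p_bound p_inj))
    (@next _ _ (context_machine p_bound p_inj)) s t = 1; last by rewrite mulr1.
rewrite /transition (exchange_big_dep predT) //=.
have [v [x ->]] : exists v : m.-tuple bool, exists x, t = [tuple of rcons v x].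
  case/tupleP: t => b u; exists [tuple of belast b u], (last b u).
  by apply: val_inj; rewrite /= lastI.
rewrite (bigD1 x) //= (eq_bigl (fun s => context_next s x == [tuple of rcons v x])).
  rewrite sum_predecessors /context_emit big1 ?addr0 => [|y yx].
    by case: (x) => //; have := p1 v; lra.
  rewrite big_pred0 // => u; case/tupleP: u => b u; rewrite context_next_cons.
  by rewrite (inj_eq Some_inj) -val_eqE /= eqseq_rcons eq_sym (negbTE yx) andbF.
by move=> u; rewrite (inj_eq Some_inj).
Qed.

(* [pickle] only serves to make the tilts of the suffixes distinct. *)
Definition tilted (k : R) (u : m.+1.-tuple bool) : R :=
  2^-1 + (if thead u then k else - k) / (pickle (behead u)).+3%:R.

Lemma tilted_bound k u : 0 < k <= 1 -> 0 < tilted k u < 1.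
Proof.
move=> /andP[k0 k1]; rewrite /tilted.
(* The shift by 3 bounds the tilt by a third, which keeps the parameter strictly between 0 and 1. *)
set n := (pickle _).+3; have n3 : (3 : R) <= n%:R by rewrite ler_nat.
have n0 : (0 : R) < n%:R by lra.
have h : k / n%:R <= 3^-1 by rewrite ler_pdivrMr //; lra.
have h0 : 0 < k / n%:R by rewrite divr_gt0.
by case: (thead u); rewrite ?mulNr; lra.
Qed.

(** The sign of the tilt gives the first letter and its size gives the suffix. *)
Lemma tilted_inj k : 0 < k -> injective (tilted k).
Proof.
move=> k0 u v; rewrite /tilted.
set i := (pickle (behead u)).+3; set j := (pickle (behead v)).+3.
have hi : 0 < k / i%:R by rewrite divr_gt0.
have hj : 0 < k / j%:R by rewrite divr_gt0.
move/addrI => uv.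
have huv : thead u = thead v.
  by move: uv; case: (thead u) (thead v) => -[]; rewrite ?mulNr //; lra.
have : k / i%:R = k / j%:R.
  by move: uv; rewrite huv; case: (thead v) => //; rewrite !mulNr => /oppr_inj.
move/(mulfI (lt0r_neq0 k0))/invr_inj/eqP; rewrite eqr_nat => /eqP [].
move/(pcan_inj pickleK) => buv.
apply: val_inj; rewrite (tuple_eta u) (tuple_eta v) /= huv.
by congr cons.
Qed.

Lemma tilted_balanced k (v : m.-tuple bool) :
  tilted k [tuple of true :: v] + tilted k [tuple of false :: v] = 1.
Proof.
rewrite /tilted !theadE /=.
by rewrite mulNr addrACA subrr; lra.
Qed.

Lemma horizon_not_identifying n : (n <= m.+1)%N ->
  exists P Q : process R bool,
    [/\ Theta_ex m.+1 1 P, Theta_ex m.+1 1 Q, same_block_law n P Q &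
        forall GP GQ : emachine R bool,
          presents m.+1 1 GP P -> presents m.+1 1 GQ Q -> ~ isomorphic GP GQ].
Proof.
move=> nm.
have k1 : 0 < (1 : R) <= 1 by rewrite ltr01 lexx.
have k2 : 0 < (2^-1 : R) <= 1 by apply/andP; split; lra.
pose GP := context_machine (fun u => tilted_bound u k1) (tilted_inj ltr01).
pose GQ := context_machine (fun u => tilted_bound u k2) (tilted_inj (proj1 (andP k2))).
have [P GPP] := generates_exists GP; have [Q GQQ] := generates_exists GQ.
have initP (s : state GP) : init s = 2^-1 ^+ m.+1.
  by apply: balanced_init; exact: tilted_balanced.
have initQ (s : state GQ) : init s = 2^-1 ^+ m.+1.
  by apply: balanced_init; exact: tilted_balanced.
exists P, Q; split.
- split; first exact: generates_stationary GPP.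
  by exists GP; exact: context_presents.
- split; first exact: generates_stationary GQQ.
  by exists GQ; exact: context_presents.
- move=> w wn; rewrite (generates_word_law _ GPP) (generates_word_law _ GQQ).
  rewrite !machine_word_sum; apply: eq_bigr => t _.
  by rewrite !context_word_state ?wn // initP initQ.
(* Whatever machines present [P] and [Q], an isomorphism between them would make all word laws of
   [P] and [Q] equal. *)
move=> GP' GQ' [GP'P _ _ _] [GQ'Q _ _ _] /isomorphic_word iso.
(* One letter beyond the order reveals a parameter: equality here would identify the tilts [d] and
   [d / 2] of the all-true context. *)
pose u := [tuple of true :: nseq m true].
have := iso (val u ++ [:: true]).
rewrite -(generates_word_law _ GP'P) -(generates_word_law _ GQ'Q).
rewrite (generates_word_law _ GPP) (generates_word_law _ GQQ).
rewrite !context_word initP initQ /wprob /= !mulr1.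
have x0 : 2^-1 ^+ m.+1 != 0 :> R by rewrite expf_neq0 // invr_eq0 pnatr_eq0.
move/(mulfI x0); rewrite /tilted theadE => /addrI.
set d := (_.+3%:R)^-1; have d0 : 0 < d by rewrite invr_gt0.
lra.
Qed.

End balanced.

(** * Comparison of the horizons *)

Lemma count_ratio_Theta (R : realType) :
  (fun m : nat => (2 ^+ (m + 1) - 1) / (2 * m%:R + 2) : R^o)
    =Theta_\oo (fun m : nat => 2 ^+ m / m%:R : R^o).
Proof.
(* For [1 <= m] one has [2 ^+ m <= 2 ^+ (m + 1) - 1 <= 2 * 2 ^+ m] and
   [2 * m <= 2 * m + 2 <= 4 * m], whence the constants. *)
rewrite eqThetaE qualifE; apply/asboolP; exists (4^-1, 1) => /=.
  by rewrite ltr01 andbT; lra.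
exists 1%N => // m /= m1.
have m0 : 1 <= m%:R :> R by rewrite ler1n.
have p1 : 1 <= 2 ^+ m :> R by rewrite exprn_ege1 // ler1n.
have d0 : 0 < 2 * m%:R + 2 :> R by lra.
have p2 : 2 ^+ (m + 1) = 2 * 2 ^+ m :> R by rewrite addn1 exprS.
rewrite p2 !ger0_norm ?divr_ge0 //; try lra.
rewrite mul1r; split.
  by rewrite mulrA ler_pdivrMr ?ltr0n // mulrAC ler_pdivlMr //; nra.
by rewrite ler_pdivrMr // mulrAC ler_pdivlMr ?ltr0n //; nra.
Qed.

Section sizes.
Context (R : realType) (m : nat) (p q : m.+1.-tuple bool -> R).
Hypotheses (p_bound : forall u, 0 < p u < 1) (q_bound : forall u, 0 < q u < 1).
Hypotheses (p_inj : injective p) (q_inj : injective q).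

Lemma context_n_struct :
  n_struct (context_machine p_bound p_inj) (context_machine q_bound q_inj) =
  ((2 * m.+1 + 2)%N%:R)%:E.
Proof.
rewrite /n_struct !context_L_tar !context_L_sep maxxx -!EFinD; congr EFin.
by rewrite natrD natrM; ring.
Qed.

Lemma context_n_count :
  n_count (context_machine p_bound p_inj) (context_machine q_bound q_inj) =
  (2 ^ (m.+1 + 1) - 1)%N.
Proof. by rewrite /n_count !card_tuple card_bool addn1 (expnS _ m.+1) mul2n addnn. Qed.

Lemma context_n_rank P Q :
  generates (context_machine p_bound p_inj) P ->
  generates (context_machine q_bound q_inj) Q ->
  n_rank P Q = ((2 ^ (m.+1 + 1) - 1)%N%:R)%:E.
Proof.
move=> GP GQ; rewrite /n_rank (context_hankel_rank GP) (context_hankel_rank GQ).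
rewrite -!EFinD natrB ?expn_gt0 // natrX addn1 (exprS _ m.+1); congr EFin; ring.
Qed.

End sizes.

Theorem corollary6p3 (R : realType) :
  [/\ forall (m : nat) (p q : m.-tuple bool -> R)
        (p_bound : forall u, 0 < p u < 1) (q_bound : forall u, 0 < q u < 1)
        (p_inj : injective p) (q_inj : injective q),
        (1 <= m)%N ->
        let GP := context_machine p_bound p_inj in
        let GQ := context_machine q_bound q_inj in
        [/\ n_struct GP GQ = ((2 * m + 2)%N%:R)%:E,
            n_count GP GQ = (2 ^ (m + 1) - 1)%N,
            forall P Q : process R bool, generates GP P -> generates GQ Q ->
              n_rank P Q = ((2 ^ (m + 1) - 1)%N%:R)%:E,
            (2 <= m)%N -> (n_struct GP GQ < ((n_count GP GQ)%:R)%:E)%E &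
            (n_count GP GQ)%:R / fine (n_struct GP GQ) =
              (2 ^+ (m + 1) - 1) / (2 * m%:R + 2)],
      (fun m : nat => (2 ^+ (m + 1) - 1) / (2 * m%:R + 2) : R^o)
        =Theta_\oo (fun m : nat => 2 ^+ m / m%:R : R^o) &
      forall m n : nat, (1 <= m)%N -> (n <= m)%N ->
        exists P Q : process R bool,
          [/\ Theta_ex m 1 P, Theta_ex m 1 Q, same_block_law n P Q &
              forall GP GQ : emachine R bool,
                presents m 1 GP P -> presents m 1 GQ Q ->
                ~ isomorphic GP GQ]].
Proof.
split; last 2 first.
- exact: count_ratio_Theta.
- by case=> [//|m] n _; exact: horizon_not_identifying.
case=> [//|m] p q p_bound q_bound p_inj q_inj _ GP GQ.
rewrite /GP /GQ context_n_struct context_n_count; split => //.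
- by move=> P Q; exact: context_n_rank.
- move=> m2; rewrite lte_fin ltr_nat addn1.
  (* Doubling this bound gives the claim; its induction starts at order 2, where it reads
     [2 < 3]. *)
  have : (m.+1 < 2 ^ m.+1 - 1)%N.
    case: m m2 {p q p_bound q_bound p_inj q_inj GP GQ} => // m _.
    elim: m => // m IH; rewrite expnS; lia.
  by rewrite (expnS _ m.+1); lia.
- by rewrite natrB ?expn_gt0 // natrD natrM natrX.
Qed.
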